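(* Let $x_0\in\mathbb{R}^n$ be given, let $\epsilon = \epsilon_A + \epsilon_B$, and let $\tau>0$, $\gamma>0$, $\beta>0$ be constants. Consider the convex optimization problem over $\mathbf{\Phi} = \begin{bmatrix} \mathbf{\Phi}_x \\ \mathbf{\Phi}_u \end{bmatrix}$ with $\mathbf{\Phi}_x\in\mathcal{L}_{TV}^{T,n\times n}$, $\mathbf{\Phi}_u\in\mathcal{L}_{TV}^{T,m\times n}$: $$\begin{aligned} \min_{\mathbf{\Phi}}\quad & \left\lVert \begin{bmatrix} \mathcal{Q}^{1/2} & 0 \\ 0 & \mathcal{R}^{1/2}\end{bmatrix}\begin{bmatrix}\mathbf{\Phi}_x(:,0)\\ \mathbf{\Phi}_u(:,0)\end{bmatrix}x_0\right\rVert_2^2 \\ \text{s.t.}\quad & \begin{bmatrix} I - Z\hat{\mathbf{A}} & -Z\hat{\mathbf{B}}\end{bmatrix}\begin{bmatrix}\mathbf{\Phi}_x\\ \mathbf{\Phi}_u\end{bmatrix} = I, \\ & F_j^\top\mathbf{\Phi}^0x_0 + \lVert F_j^\top\mathbf{\Phi}^{\tilde{\mathbf{w}}}\rVert_1\,\frac{1-\tau^T}{1-\tau}\,\gamma + \beta\sigma_w \leq b_j, \quad \forall j, \\ & \lVert F_j^\top\mathbf{\Phi}^{\tilde{\mathbf{w}}}\rVert_{\infty\rightarrow\infty} + \beta\,\lVert\epsilon\,\mathbf{\Phi}^{\tilde{\mathbf{w}}}\rVert_{\infty\rightarrow\infty}\leq\beta,\quad \forall j, \\ & \left\lVert\begin{bmatrix}\epsilon_A\mathbf{\Phi}_x^{\tilde{\mathbf{w}}}\\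 \epsilon_B\mathbf{\Phi}_u^{\tilde{\mathbf{w}}}\end{bmatrix}\right\rVert_{\infty\rightarrow\infty}\leq \tau/2, \\ & \left\lVert\begin{bmatrix}\epsilon_A\mathbf{\Phi}_x^{0}\\ \epsilon_B\mathbf{\Phi}_u^{0}\end{bmatrix}x_0\right\rVert_{\infty}\leq \gamma/2 . \end{aligned}$$ Then, for any $(\tau,\gamma,\beta)$ and any feasible solution $\mathbf{\Phi}$ of this problem, the synthesized controller $\mathbf{K}=\mathbf{\Phi}_u\mathbf{\Phi}_x^{-1}\in\mathcal{L}_{TV}^{T,m\times n}$, i.e. $u_t=\sum_{i=0}^{t}K^{t,t-i}x_i$, guarantees constraint satisfaction under all possible model uncertainty and disturbances. That is, for all $\mathbf{\Delta}_A\in\mathcal{L}_{TV}^{T,n\times n}$ with $\lVert\mathbf{\Delta}_A\rVert_{\infty\rightarrow\infty}\leq\epsilon_A$, all $\mathbf{\Delta}_B\in\mathcal{L}_{TV}^{T,n\times m}$ with $\lVert\mathbf{\Delta}_B\rVert_{\infty\rightarrow\infty}\leq\epsilon_B$, and all $w_0,\dots,w_{T-1}\in\mathbb{R}^n$ with $\lVert w_t\rVert_\infty\leq\sigma_w$, the closed-loop trajectory starting from $x_0$ and defined by $$x_{t+1}=\hat A_tx_t+\sum_{i=0}^{t}\Delta_A^{t,t-i}x_i+\hat B_tu_t+\sum_{i=0}^{t}\Delta_B^{t,t-i}u_i+w_t,\qquad u_t=\sum_{i=0}^{t}K^{t,t-i}x_i,\qquad t=0,\dots,T-1,$$ satisfies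 $x_t\in\mathcal{X}$ and $u_t\in\mathcal{U}$ for all $t=0,\dots,T-1$, and $x_T\in\mathcal{X}_T$.
   Context: Fix a horizon $T\ge1$, dimensions $n,m\ge1$, uncertainty levels $\epsilon_A,\epsilon_B$ (nonnegative reals), and a disturbance bound $\sigma_w\ge 0$. Block-lower-triangular operators: $\mathcal{L}_{TV}^{T,p\times q}$ is the set of real $(T+1)p\times(T+1)q$ matrices $\mathbf{R}$ partitioned into $(T+1)\times(T+1)$ blocks of size $p\times q$, with block rows and columns indexed $0,\dots,T$, whose blocks strictly above the block diagonal vanish; the block in block row $i$ and block column $j\le i$ is denoted $R^{i,i-j}$. $\mathbf{R}(:,j)$ denotes the $j$-th block column (indexed from $0$). Nominal model: $\hat A_t\in\mathbb{R}^{n\times n}$, $\hat B_t\in\mathbb{R}^{n\times m}$ for $t=0,\dots,T-1$ are given; $\hat{\mathbf{A}}=\mathrm{blkdiag}(\hat A_0,\dots,\hat A_{T-1},0)$, $\hat{\mathbf{B}}=\mathrm{blkdiag}(\hat B_0,\dots,\hat B_{T-1},0)$ (last zero blocks of sizes $n\times n$, $n\times m$). $Z\in\mathbb{R}^{(T+1)n\times(T+1)n}$ is the block-downshift operator, with $I_n$ on the first block subdiagonal and zeros elsewhere. Constraints: $\mathcal{X}=\{x\in\mathbb{R}^n\mid F_xx\le b_x\}$, $\mathcal{U}=\{u\in\mathbb{R}^m\mid F_uu\le b_u\}$, $\mathcal{X}_T=\{x\in\mathbb{R}^n\mid F_Tx\le b_T\}$ are given polytopes (inequalities are element-wise). They are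 stacked as $$F=\mathrm{blkdiag}(\underbrace{F_x,\dots,F_x}_{T},F_T,\underbrace{F_u,\dots,F_u}_{T+1}),\qquad b=[\,\underbrace{b_x^\top\cdots b_x^\top}_{T}\ b_T^\top\ \underbrace{b_u^\top\cdots b_u^\top}_{T+1}\,]^\top,$$ acting on the stacked vector $[x_0^\top\cdots x_T^\top\ u_0^\top\cdots u_T^\top]^\top$. $F_j^\top$ denotes the $j$-th row of $F$ and $b_j$ the $j$-th entry of $b$; ''$\forall j$'' ranges over all rows of $F$. Partition of $\mathbf{\Phi}$: $\mathbf{\Phi}=[\,\mathbf{\Phi}^0\mid\mathbf{\Phi}^{\tilde{\mathbf{w}}}\,]=\left[\begin{array}{c|c}\mathbf{\Phi}_x^0&\mathbf{\Phi}_x^{\tilde{\mathbf{w}}}\\ \hline \mathbf{\Phi}_u^0&\mathbf{\Phi}_u^{\tilde{\mathbf{w}}}\end{array}\right]$, where $\mathbf{\Phi}^0$ is the first block column ($n$ columns, block column index $0$) of $\mathbf{\Phi}$ and $\mathbf{\Phi}^{\tilde{\mathbf{w}}}$ consists of the remaining block columns. Norms: $\lVert\cdot\rVert_{\infty\rightarrow\infty}$ is the matrix norm induced by the vector $\infty$-norm (maximum absolute row sum); $\lVert F_j^\top\mathbf{\Phi}^{\tilde{\mathbf{w}}}\rVert_1$ is the vector $\ell_1$ norm of the row vector $F_j^\top\mathbf{\Phi}^{\tilde{\mathbf{w}}}$. The expression $\frac{1-\tau^T}{1-\tau}$ stands for $\sum_{k=0}^{T-1}\tau^k$ (equal to $T$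 when $\tau=1$). Cost: $\mathcal{Q}=\mathrm{blkdiag}(Q_0,\dots,Q_{T-1},Q_T)$ and $\mathcal{R}=\mathrm{blkdiag}(R_0,\dots,R_{T-1},0)$ with given weights $Q_t\succeq0$ ($t=0,\dots,T$) in $\mathbb{R}^{n\times n}$ and $R_t\succ0$ in $\mathbb{R}^{m\times m}$. *)

(* Defs.v *)
(* MathComp / MathComp-Analysis world. *)
From HB Require Import structures.
From mathcomp Require Import all_boot all_order all_algebra.
From mathcomp Require Import boolp classical_sets reals topology normedtype.

Set Implicit Arguments.
Unset Strict Implicit.
Unset Printing Implicit Defensive.

Import Order.TTheory GRing.Theory Num.Theory.
Import numFieldNormedType.Exports.
Local Open Scope classical_set_scope.
Local Open Scope ring_scope.

(* On column vectors the norm `| _ | of MathComp-Analysis is the infinity norm,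
   the largest absolute value of an entry. *)

Definition norm_oo (R : realType) (k l : nat) (M : 'M[R]_(k, l)) : R :=
  \big[Num.max/0]_(i < k) \sum_(j < l) `|M i j|.

Definition norm_1 (R : realType) (k : nat) (v : 'rV[R]_k) : R :=
  \sum_(j < k) `|v 0 j|.

Definition norm_2 (R : realType) (k : nat) (v : 'cV[R]_k) : R :=
  Num.sqrt (\sum_(i < k) v i 0 ^+ 2).

Definition psdmx (R : realType) (k : nat) (A : 'M[R]_k) : Prop :=
  A^T = A /\ forall v : 'cV[R]_k, 0 <= (v^T *m A *m v) 0 0.

Definition posdefmx (R : realType) (k : nat) (A : 'M[R]_k) : Prop :=
  A^T = A /\ forall v : 'cV[R]_k, v != 0 -> 0 < (v^T *m A *m v) 0 0.

(* The principal square root: for positive semidefinite A, the set below has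
   exactly one element.  The default value 0 is only used for other A. *)
Definition sqrtmx (R : realType) (k : nat) (A : 'M[R]_k) : 'M[R]_k :=
  xget 0 [set S | psdmx S /\ S *m S = A].

Definition polytope (R : realType) (c k : nat) (F : 'M[R]_(c, k))
    (b : 'cV[R]_c) : set 'cV[R]_k :=
  [set x | forall j, (F *m x) j 0 <= b j 0].

(* Matrices of (T+1) x (T+1) blocks of size p x q; the dimensions have the form
   expected by submxblock and \mxblock.  The block usually written R^{i,i-j}
   is blk R i j: i is the block row and j the block column. *)
Notation opmx R T p q := 'M[R]_(\sum_(i < T.+1) p, \sum_(j < T.+1) q).

Definition blk (R : realType) (T p q : nat) (M : opmx R T p q)
    (i j : 'I_T.+1) : 'M[R]_(p, q) :=
  submxblock M i j.

Definition L_TV (R : realType) (T p q : nat) : set (opmx R T p q) :=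
  [set M | forall i j : 'I_T.+1, (i < j)%N -> blk M i j = 0].

(* mxdiag only allows square diagonal blocks. *)
Definition blkdiag (R : realType) (k : nat) (p : 'I_k -> nat) (q : nat)
    (D : forall i, 'M[R]_(p i, q)) :
    'M[R]_(\sum_(i < k) p i, \sum_(j < k) q) :=
  \mxblock_(i < k, j < k) (D i *+ (i == j)).

(* blkdiag(D_0, ..., D_{T-1}, E) *)
Definition blkdiag_last (R : realType) (T p q : nat)
    (D : 'I_T -> 'M[R]_(p, q)) (E : 'M[R]_(p, q)) : opmx R T p q :=
  blkdiag (fun i : 'I_T.+1 => oapp D E (unlift ord_max i)).

Definition downshift (R : realType) (T n : nat) : opmx R T n n :=
  \mxblock_(i < T.+1, j < T.+1) ((1%:M : 'M[R]_n) *+ (i == j.+1 :> nat)).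

(* The terminal constraint may have a different number cT of rows than the
   stage constraint, hence the dependent types. *)
Definition state_rows (T cx cT : nat) (i : 'I_T.+1) : nat :=
  if i == ord_max then cT else cx.

Definition state_F (R : realType) (T n cx cT : nat) (Fx : 'M[R]_(cx, n))
    (FT : 'M[R]_(cT, n)) (i : 'I_T.+1) : 'M[R]_(state_rows cx cT i, n) :=
  if i == ord_max as e return 'M[R]_(if e then cT else cx, n)
  then FT else Fx.

Definition state_b (R : realType) (T cx cT : nat) (bx : 'cV[R]_cx)
    (bT : 'cV[R]_cT) (i : 'I_T.+1) : 'cV[R]_(state_rows cx cT i) :=
  if i == ord_max as e return 'cV[R]_(if e then cT else cx)
  then bT else bx.

Definition stack_F (R : realType) (T n m cx cT cu : nat) (Fx : 'M[R]_(cx, n))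
    (FT : 'M[R]_(cT, n)) (Fu : 'M[R]_(cu, m)) :
    'M[R]_(\sum_(i < T.+1) state_rows cx cT i + \sum_(i < T.+1) cu,
           \sum_(i < T.+1) n + \sum_(i < T.+1) m) :=
  block_mx (blkdiag (state_F Fx FT)) 0 0 (blkdiag (fun _ : 'I_T.+1 => Fu)).

Definition stack_b (R : realType) (T cx cT cu : nat) (bx : 'cV[R]_cx)
    (bT : 'cV[R]_cT) (bu : 'cV[R]_cu) :
    'cV[R]_(\sum_(i < T.+1) state_rows cx cT i + \sum_(i < T.+1) cu) :=
  col_mx (\mxcol_(i < T.+1) state_b bx bT i) (\mxcol_(i < T.+1) bu).

(* [ blkcol0 M | blkcols_w M ] splits off the block column of index 0. *)
Definition blkcol0 (R : realType) (T n k : nat)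
    (M : 'M[R]_(k, \sum_(j < T.+1) n)) : 'M[R]_(k, n) :=
  submxrow M ord0.

Definition blkcols_w (R : realType) (T n k : nat)
    (M : 'M[R]_(k, \sum_(j < T.+1) n)) : 'M[R]_(k, \sum_(j < T) n) :=
  \mxrow_(j < T) submxrow M (lift ord0 j).

Notation respmx R T n m :=
  'M[R]_(\sum_(i < T.+1) n + \sum_(i < T.+1) m, \sum_(j < T.+1) n).

Record min_problem (R : realType) (V : Type) := MinProblem {
  objective : V -> R;
  feasible : set V
}.

Definition slp_objective (R : realType) (T n m : nat) (Q : opmx R T n n)
    (W : opmx R T m m) (x0 : 'cV[R]_n) (Phi : respmx R T n m) : R :=
  norm_2 (block_mx (sqrtmx Q) 0 0 (sqrtmx W) *m
          col_mx (blkcol0 (usubmx Phi)) (blkcol0 (dsubmx Phi)) *m x0) ^+ 2.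

(* The sum of the powers of tau is (1 - tau^T) / (1 - tau), read as T when
   tau = 1. *)
Record slp_feasible (R : realType) (T n m r : nat) (A : opmx R T n n)
    (B : opmx R T n m) (F : 'M[R]_(r, \sum_(i < T.+1) n + \sum_(i < T.+1) m))
    (b : 'cV[R]_r) (epsA epsB sigw : R) (x0 : 'cV[R]_n) (tau gamma beta : R)
    (Phi : respmx R T n m) : Prop := SlpFeasible {
  slp_causal_x : L_TV (usubmx Phi);
  slp_causal_u : L_TV (dsubmx Phi);
  slp_affine :
    row_mx (1%:M - downshift R T n *m A) (- (downshift R T n *m B)) *m Phi
      = 1%:M;
  slp_tightened : forall j : 'I_r,
    (row j F *m blkcol0 Phi *m x0) 0 0
      + norm_1 (row j F *m blkcols_w Phi) * (\sum_(k < T) tau ^+ k) * gamma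
      + beta * sigw <= b j 0;
  slp_beta : forall j : 'I_r,
    norm_oo (row j F *m blkcols_w Phi)
      + beta * norm_oo ((epsA + epsB) *: blkcols_w Phi) <= beta;
  slp_tau :
    norm_oo (col_mx (epsA *: blkcols_w (usubmx Phi))
                    (epsB *: blkcols_w (dsubmx Phi))) <= tau / 2;
  slp_gamma :
    `|col_mx (epsA *: blkcol0 (usubmx Phi))
             (epsB *: blkcol0 (dsubmx Phi)) *m x0| <= gamma / 2
}.

Definition robust_slp (R : realType) (T n m r : nat) (A : opmx R T n n)
    (B : opmx R T n m) (Q : opmx R T n n) (W : opmx R T m m)
    (F : 'M[R]_(r, \sum_(i < T.+1) n + \sum_(i < T.+1) m)) (b : 'cV[R]_r)
    (epsA epsB sigw : R) (x0 : 'cV[R]_n) (tau gamma beta : R) :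
    min_problem R (respmx R T n m) :=
  MinProblem (slp_objective Q W x0)
    [set Phi | slp_feasible A B F b epsA epsB sigw x0 tau gamma beta Phi].

Definition slp_controller (R : realType) (T n m : nat)
    (Phi : respmx R T n m) : opmx R T m n :=
  dsubmx Phi *m invmx (usubmx Phi).

(* t : 'I_T as the times t and t + 1 in {0, ..., T} *)
Definition now (T : nat) (t : 'I_T) : 'I_T.+1 := widen_ord (leqnSn T) t.
Definition next (T : nat) (t : 'I_T) : 'I_T.+1 := lift ord0 t.

Record closed_loop (R : realType) (T n m : nat) (A : 'I_T -> 'M[R]_n)
    (B : 'I_T -> 'M[R]_(n, m)) (dA : opmx R T n n) (dB : opmx R T n m)
    (w : 'I_T -> 'cV[R]_n) (K : opmx R T m n) (x0 : 'cV[R]_n)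
    (x : 'I_T.+1 -> 'cV[R]_n) (u : 'I_T -> 'cV[R]_m) : Prop := ClosedLoop {
  closed_loop_init : x ord0 = x0;
  closed_loop_state : forall t : 'I_T,
    x (next t) =
      A t *m x (now t)
      + \sum_(i < T | (i <= t)%N) blk dA (now t) (now i) *m x (now i)
      + B t *m u t
      + \sum_(i < T | (i <= t)%N) blk dB (now t) (now i) *m u i
      + w t;
  closed_loop_input : forall t : 'I_T,
    u t = \sum_(i < T | (i <= t)%N) blk K (now t) (now i) *m x (now i)
}.

(* Main.v *)
Require Import Defs.
From HB Require Import structures.
From mathcomp Require Import all_boot all_order all_algebra.
From mathcomp Require Import boolp classical_sets reals topology normedtype.
Import Order.TTheory GRing.Theory Num.Theory.
Import numFieldNormedType.Exports.
Local Open Scope classical_set_scope.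
Local Open Scope ring_scope.

(** Write Phi_x, Phi_u for the two block rows of Phi, X and V for the stacked
    state and input, and let eta = Phi_x^-1 X, so that X = Phi_x eta and
    V = Phi_u eta.  The affine constraint says that eta is exactly what the
    nominal model fails to explain: its first block is x_0, and its block t+1
    is the model error at time t plus w_t.  Let D stack the model errors of the
    times 0, ..., T-1, and let eta' be eta without its first block.  Since
    Phi eta = Phi^0 x_0 + Phi^w eta', the lumped disturbance eta' solves the
    fixed point equation
      eta' = D Phi^w eta' + D Phi^0 x_0 + w.

    All factors are causal and Phi^w starts one block later, so M = D Phi^w is
    strictly causal, hence M^T = 0.  Split eta' = v1 + v2 according to the two
    sources D Phi^0 x_0 and w.  Splitting D into its A- and B-parts and moving
    the levels eps_A, eps_B onto Phi, slp_tau and slp_gamma give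
    |M y| <= tau |y| and |D Phi^0 x_0| <= gamma; summing the finite Neumann
    series for v1, |v1| <= (1 + tau + ... + tau^(T-1)) gamma.  For v2 one uses
    instead |M y| <= rho |y| with rho = (eps_A + eps_B) |Phi^w|, so that
    (1 - rho) |v2| <= sigma_w, while slp_beta reads
    |F_j Phi^w| <= beta (1 - rho); together F_j Phi^w v2 <= beta sigma_w
    (robust_row_bound).  Adding F_j Phi^0 x_0, slp_tightened gives
    F_j (X, V) <= b_j for every row j, which is the claim.

    Invertibility of Phi_x and causality of its inverse come from the same
    mechanism: the affine constraint makes Phi_x the identity minus a strictly
    causal operator, so its inverse is a finite sum of causal powers
    (response_unit). *)

(** * Causality as an entrywise delay *)

(** [d] and [e] assign a time to each row and column; no output depends on an
    input less than [k] steps old.  Stating causality on entries rather than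
    on blocks lets it compose without matching block sizes, and with k = 1 it
    also covers strict causality. *)
Definition delayed {R : realType} {p q : nat} (d : 'I_p -> nat)
    (e : 'I_q -> nat) (k : nat) (M : 'M[R]_(p, q)) : Prop :=
  forall i j, (d i < e j + k)%N -> M i j = 0.

Lemma delayed_mul {R : realType} {p q r : nat} (d : 'I_p -> nat)
    (e : 'I_q -> nat) (f : 'I_r -> nat) (k l : nat)
    (M : 'M[R]_(p, q)) (N : 'M[R]_(q, r)) :
  delayed d e k M -> delayed e f l N -> delayed d f (k + l) (M *m N).
Proof.
move=> dM dN i j lt_ij; rewrite mxE big1 // => h _.
have [/dM->|le_hi] := ltnP (d i) (e h + k); first by rewrite mul0r.
rewrite dN ?mulr0 // -(ltn_add2r k); apply: leq_ltn_trans le_hi _.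
by rewrite -addnA [(l + k)%N]addnC.
Qed.

Lemma delayed_add {R : realType} {p q : nat} (d : 'I_p -> nat)
    (e : 'I_q -> nat) (k : nat) (M N : 'M[R]_(p, q)) :
  delayed d e k M -> delayed d e k N -> delayed d e k (M + N).
Proof. by move=> dM dN i j lt_ij; rewrite mxE dM // dN // addr0. Qed.

Lemma delayed_opp {R : realType} {p q : nat} (d : 'I_p -> nat)
    (e : 'I_q -> nat) (k : nat) (M : 'M[R]_(p, q)) :
  delayed d e k M -> delayed d e k (- M).
Proof. by move=> dM i j lt_ij; rewrite mxE dM // oppr0. Qed.

Lemma delayed_weaken {R : realType} {p q : nat} (d : 'I_p -> nat)
    (e : 'I_q -> nat) (k : nat) (M : 'M[R]_(p, q)) :
  delayed d e k M -> delayed d e 0 M.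
Proof.
by move=> dM i j; rewrite addn0 => /ltn_addr lt_ij; exact/dM/lt_ij.
Qed.

Lemma delayed_exp {R : realType} {p : nat} (d : 'I_p -> nat)
    (M : 'M[R]_p) (k : nat) :
  delayed d d 1 M -> delayed d d k (M ^+ k).
Proof.
move=> dM; elim: k => [|k IHk].
  move=> i j; rewrite addn0 expr0 => lt_ij; rewrite mxE.
  by case: eqP lt_ij => // ->; rewrite ltnn.
by rewrite exprS -add1n; exact: delayed_mul dM IHk.
Qed.

(** Each application costs one step, and only [k] times are available. *)
Lemma delayed_nilpotent {R : realType} {p : nat} (d : 'I_p -> nat) (k : nat)
    (M : 'M[R]_p) :
  (forall i, (d i < k)%N) -> delayed d d 1 M -> M ^+ k = 0.
Proof.
move=> d_lt dM; apply/matrixP => i j; rewrite mxE.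
by apply: (delayed_exp d M k dM); exact: ltn_addl.
Qed.

Lemma neumann_mul {R : realType} {p : nat} (M : 'M[R]_p) (k : nat) :
  M ^+ k = 0 -> (1%:M - M) *m (\sum_(i < k) M ^+ i) = 1%:M.
Proof.
move=> Mk0; have := subrX1 M k; rewrite Mk0 sub0r => eqM.
by rewrite -[1%:M - M]opprB mulNmx -[LHS]/(- ((M - 1) * _)) -eqM opprK.
Qed.

(** The inverse is the finite Neumann series of [M], whose terms are all
    causal. *)
Lemma delayed_inverse {R : realType} {p : nat} (d : 'I_p -> nat) (k : nat)
    (M : 'M[R]_p) :
  (forall i, (d i < k)%N) -> delayed d d 1 M ->
  1%:M - M \in unitmx /\ delayed d d 0 (invmx (1%:M - M)).
Proof.
move=> d_lt dM; have Mk0 := delayed_nilpotent d k M d_lt dM.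
have MS1 := neumann_mul M k Mk0; have [uM _] := mulmx1_unit MS1.
split=> //; have := mulKmx uM (\sum_(i < k) M ^+ i); rewrite MS1 mulmx1 => ->.
elim/big_rec: _ => [i j _|i S _ dS]; first by rewrite mxE.
by apply: delayed_add dS; exact/(delayed_weaken _ _ i)/delayed_exp.
Qed.

(** * Infinity norms *)

Lemma cVnorm_le {R : realType} {p : nat} (v : 'cV[R]_p) (c : R) :
  0 <= c -> (forall i, `|v i 0| <= c) -> `|v| <= c.
Proof.
move=> c_ge0 le_vc; rewrite [leLHS]mx_normrE.
by apply/bigmax_leP; split=> // -[i j] _ /=; rewrite ord1.
Qed.

Lemma cVnorm_ge {R : realType} {p : nat} (v : 'cV[R]_p) (i : 'I_p) :
  `|v i 0| <= `|v|.
Proof.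
rewrite [leRHS]mx_normrE.
exact: (le_bigmax 0 (fun ij => `|v ij.1 ij.2|) (i, ord0)).
Qed.

Lemma norm_oo_ge0 {R : realType} {p q : nat} (M : 'M[R]_(p, q)) :
  0 <= norm_oo M.
Proof. exact: bigmax_ge_id. Qed.

Lemma norm_oo_row {R : realType} {p : nat} (v : 'rV[R]_p) :
  norm_oo v = norm_1 v.
Proof. by rewrite /norm_oo big_ord_recl big_ord0 max_l // sumr_ge0. Qed.

Lemma norm_oo_row_sum {R : realType} {p q : nat} (M : 'M[R]_(p, q)) i :
  \sum_j `|M i j| <= norm_oo M.
Proof. exact: (le_bigmax 0 (fun i => \sum_j `|M i j|) i). Qed.

Lemma norm_oo_mul {R : realType} {p q : nat} (M : 'M[R]_(p, q))
    (v : 'cV[R]_q) :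
  `|M *m v| <= norm_oo M * `|v|.
Proof.
apply: cVnorm_le => [|i]; first by rewrite mulr_ge0 ?norm_oo_ge0.
apply: le_trans (ler_wpM2r (normr_ge0 v) (norm_oo_row_sum M i)).
rewrite mxE (le_trans (ler_norm_sum _ _ _)) // mulr_suml.
by apply: ler_sum => j _; rewrite normrM ler_wpM2l // cVnorm_ge.
Qed.

Lemma cVnormZ {R : realType} {p : nat} (a : R) (v : 'cV[R]_p) :
  `|a *: v| = `|a| * `|v|.
Proof. exact: mx_normZ. Qed.

Lemma col_mx_norm_ge {R : realType} {p q : nat} (y : 'cV[R]_p)
    (z : 'cV[R]_q) :
  `|y| <= `|col_mx y z| /\ `|z| <= `|col_mx y z|.
Proof.
split; apply: cVnorm_le => // i.
  by rewrite -(col_mxEu y z); exact: cVnorm_ge.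
by rewrite -(col_mxEd y z); exact: cVnorm_ge.
Qed.

(** The uncertainty levels are moved from the perturbations onto the signals;
    the factor 2 is the price of bounding both summands by the common maximum,
    and it is what the halves in the tau and gamma constraints pay for. *)
Lemma perturbation_le_scaled {R : realType} {s p q : nat} (epsA epsB : R)
    (dA : 'M[R]_(s, p)) (dB : 'M[R]_(s, q)) (y : 'cV[R]_p) (z : 'cV[R]_q) :
  0 <= epsA -> 0 <= epsB -> norm_oo dA <= epsA -> norm_oo dB <= epsB ->
  `|dA *m y + dB *m z| <= 2 * `|col_mx (epsA *: y) (epsB *: z)|.
Proof.
move=> A_ge0 B_ge0 dA_le dB_le.
have [ley lez] := col_mx_norm_ge (epsA *: y) (epsB *: z).
rewrite (le_trans (ler_normD _ _)) // mulr2n mulrDl mul1r lerD //.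
  rewrite (le_trans (norm_oo_mul _ _)) // (le_trans _ ley) // cVnormZ.
  by rewrite ger0_norm // ler_wpM2r.
rewrite (le_trans (norm_oo_mul _ _)) // (le_trans _ lez) // cVnormZ.
by rewrite ger0_norm // ler_wpM2r.
Qed.

(** The companion bound, in which the signals stay unscaled and the levels
    add up. *)
Lemma perturbation_le_sum {R : realType} {s p q : nat} (epsA epsB : R)
    (dA : 'M[R]_(s, p)) (dB : 'M[R]_(s, q)) (y : 'cV[R]_p) (z : 'cV[R]_q) :
  norm_oo dA <= epsA -> norm_oo dB <= epsB ->
  `|dA *m y + dB *m z| <= (epsA + epsB) * `|col_mx y z|.
Proof.
move=> dA_le dB_le; have [ley lez] := col_mx_norm_ge y z.
rewrite (le_trans (ler_normD _ _)) // mulrDl lerD //.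
  by rewrite (le_trans (norm_oo_mul _ _)) // ler_pM ?norm_oo_ge0.
by rewrite (le_trans (norm_oo_mul _ _)) // ler_pM ?norm_oo_ge0.
Qed.

(** * The feedback loop of the uncertainty *)

(** The source [c] and the source [w] are propagated separately because they are
    controlled by different gains of the same loop [M]: [tau] may exceed 1 and
    is used over [T] steps only, while [rho] gives a bound independent of [T].
    The bounds |v2| (1 - rho) <= sigma and |r| <= beta (1 - rho) are multiplied
    together, never divided by 1 - rho, which may vanish. *)
Lemma robust_row_bound {R : realType} {p T : nat} {M : 'M[R]_p}
    {r : 'rV[R]_p} {c w v : 'cV[R]_p} {tau rho gamma sigma beta : R} :
  M ^+ T = 0 -> v = M *m v + (c + w) ->
  0 <= tau -> 0 <= beta ->
  (forall y : 'cV[R]_p, `|M *m y| <= tau * `|y|) ->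
  (forall y : 'cV[R]_p, `|M *m y| <= rho * `|y|) ->
  `|c| <= gamma -> `|w| <= sigma ->
  norm_oo r + beta * rho <= beta ->
  (r *m v) 0 0 <= norm_1 r * (\sum_(k < T) tau ^+ k) * gamma + beta * sigma.
Proof.
move=> MT0 v_eq tau_ge0 beta_ge0 M_tau M_rho c_le w_le r_le.
pose v1 := (\sum_(k < T) M ^+ k) *m c; pose v2 := v - v1.
have v1_eq : v1 = M *m v1 + c.
  have := congr1 (mulmx^~ c) (neumann_mul M T MT0).
  rewrite /= -mulmxA -/v1 mulmxBl !mul1mx => /eqP.
  by rewrite subr_eq addrC => /eqP.
have v2_eq : v2 = M *m v2 + w.
  by rewrite /v2 mulmxBr {1}v_eq {1}v1_eq opprD addrACA [c + w]addrC addrK.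
have v1_le : `|v1| <= (\sum_(k < T) tau ^+ k) * gamma.
  rewrite /v1 mulmx_suml mulr_suml (le_trans (ler_norm_sum _ _ _)) //.
  apply: ler_sum => k _; elim: (nat_of_ord k) => [|h IHh].
    by rewrite !expr0 mul1mx mul1r.
  rewrite !exprS -mulmxA -mulrA (le_trans (M_tau _)) //.
  by rewrite ler_wpM2l.
have r_le1 (y : 'cV[R]_p) : (r *m y) 0 0 <= norm_1 r * `|y|.
  rewrite -norm_oo_row (le_trans _ (norm_oo_mul r y)) //.
  by rewrite (le_trans (ler_norm _)) // cVnorm_ge.
have -> : v = v1 + v2 by rewrite /v2 addrC subrK.
rewrite mulmxDr mxE lerD //.
  rewrite (le_trans (r_le1 _)) // -mulrA ler_wpM2l // -norm_oo_row.
  exact: norm_oo_ge0.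
rewrite (le_trans (r_le1 _)) // -norm_oo_row.
have v2_le : `|v2| * (1 - rho) <= sigma.
  rewrite mulrBr mulr1 lerBlDl {1}v2_eq (le_trans (ler_normD _ _)) //.
  by rewrite lerD // mulrC.
have r_le2 : norm_oo r <= beta * (1 - rho).
  by rewrite mulrBr mulr1 lerBrDr.
rewrite (le_trans (ler_wpM2r (normr_ge0 v2) r_le2)) //.
by rewrite -mulrA ler_wpM2l // mulrC.
Qed.

(** * Block structure *)

Definition block_time {k : nat} {p : 'I_k -> nat} (s : 'I_(\sum_(i < k) p i)) :
  nat := tagnat.sig1 s.

Lemma block_time_lt {k : nat} {p : 'I_k -> nat} (s : 'I_(\sum_(i < k) p i)) :
  (block_time s < k)%N.
Proof. exact: ltn_ord. Qed.

Lemma L_TV_delayed {R : realType} {T p q : nat} (M : opmx R T p q) :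
  L_TV M <-> delayed block_time block_time 0 M.
Proof.
split=> [cM s c|dM i j lt_ij].
  rewrite addn0 => lt_sc; have := cM _ _ lt_sc.
  move/matrixP/(_ (tagnat.sig2 s) (tagnat.sig2 c)).
  by rewrite !mxE !tagnat.sig2K.
apply/matrixP => a c; rewrite !mxE dM //.
by rewrite /block_time !tagnat.Rank1K addn0.
Qed.

Lemma mxblock_delayed {R : realType} {k p q l : nat}
    (M : 'I_k -> 'I_k -> 'M[R]_(p, q)) :
  (forall i j : 'I_k, (i < j + l)%N -> M i j = 0) ->
  delayed block_time block_time l (\mxblock_(i < k, j < k) M i j).
Proof. by move=> M0 s c lt_sc; rewrite mxE M0 // mxE. Qed.

Lemma blkdiag_last_delayed {R : realType} {T p q : nat}
    (D : 'I_T -> 'M[R]_(p, q)) (E : 'M[R]_(p, q)) :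
  delayed block_time block_time 0 (blkdiag_last D E).
Proof.
apply: mxblock_delayed => i j; rewrite addn0.
by case: eqP => // ->; rewrite ltnn.
Qed.

Lemma downshift_delayed {R : realType} {T n : nat} :
  delayed block_time block_time 1 (downshift R T n).
Proof.
apply: mxblock_delayed => i j; rewrite addn1.
by case: eqP => // ->; rewrite ltnn.
Qed.

Lemma mxcol_Rank {R : realType} {k l : nat} {p : 'I_k -> nat}
    (C : forall i, 'M[R]_(p i, l)) i (a : 'I_(p i)) (b : 'I_l) :
  (\mxcol_i C i) (tagnat.Rank i a) b = C i a b.
Proof. by have /matrixP/(_ a b) := mxcolK C i; rewrite mxE. Qed.

Lemma submxcol_mulmx {R : realType} {k l p q : nat}
    (M : 'M[R]_(\sum_(i < k) p, \sum_(j < l) q)) (Y : 'cV[R]_(\sum_(j < l) q)) i :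
  submxcol (M *m Y) i = \sum_(j < l) submxblock M i j *m submxcol Y j.
Proof.
by rewrite -{1}[M]submxblockK -{1}[Y]submxcolK mul_mxblock_mxrow mxcolK.
Qed.

Lemma causal_mulmx_now {R : realType} {T p q : nat} (M : opmx R T p q)
    (Y : 'cV[R]_(\sum_(i < T.+1) q)) (t : 'I_T) :
  L_TV M ->
  submxcol (M *m Y) (now t) =
    \sum_(i < T | (i <= t)%N) blk M (now t) (now i) *m submxcol Y (now i).
Proof.
move=> cM; rewrite submxcol_mulmx.
(* The column block of the final time T lies above the block diagonal. *)
rewrite big_ord_recr /= [X in _ + X](_ : _ = 0) ?addr0; last first.
  by have := cM (now t) ord_max (ltn_ord t); rewrite /blk => ->; rewrite mul0mx.
rewrite [RHS]big_mkcond /=; apply: eq_bigr => i _.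
case: leqP => // lt_ti.
by have := cM (now t) (now i) lt_ti; rewrite /blk /now => ->; rewrite mul0mx.
Qed.

Lemma blkdiag_mulmx {R : realType} {k q : nat} {p : 'I_k -> nat}
    (D : forall i, 'M[R]_(p i, q)) (x : 'I_k -> 'cV[R]_q) :
  blkdiag D *m \mxcol_i x i = \mxcol_i (D i *m x i).
Proof.
rewrite mul_mxblock_mxrow; apply: eq_mxcol => i.
rewrite (bigD1 i) //= eqxx mulr1n big1 ?addr0 // => j.
by rewrite eq_sym => /negPf->; rewrite mulr0n mul0mx.
Qed.

Lemma blkdiag_last_mulmx_now {R : realType} {T p q : nat}
    (D : 'I_T -> 'M[R]_(p, q)) (E : 'M[R]_(p, q))
    (Y : 'cV[R]_(\sum_(i < T.+1) q)) (t : 'I_T) :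
  submxcol (blkdiag_last D E *m Y) (now t) = D t *m submxcol Y (now t).
Proof.
rewrite -{1}[Y]submxcolK blkdiag_mulmx mxcolK.
have {1}-> : now t = lift ord_max t by apply: ord_inj; rewrite lift_max.
by rewrite liftK.
Qed.

Lemma downshift_mulmx0 {R : realType} {T n : nat}
    (Y : 'cV[R]_(\sum_(i < T.+1) n)) :
  submxcol (downshift R T n *m Y) ord0 = 0.
Proof.
rewrite submxcol_mulmx big1 // => j _.
by rewrite mxblockK mulr0n mul0mx.
Qed.

Lemma downshift_mulmx_next {R : realType} {T n : nat}
    (Y : 'cV[R]_(\sum_(i < T.+1) n)) (t : 'I_T) :
  submxcol (downshift R T n *m Y) (lift ord0 t) = submxcol Y (now t).
Proof.
rewrite submxcol_mulmx (bigD1 (now t)) //= mxblockK lift0 eqxx mulr1n mul1mx.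
rewrite big1 ?addr0 // => j ne_jt.
rewrite mxblockK lift0 eqSS eq_sym -[X in _ == X]/(val (now t)) val_eqE.
by rewrite (negPf ne_jt) mulr0n mul0mx.
Qed.

(** Block rows 1, ..., T.  Together with [front], which keeps the block rows
    0, ..., T-1, it removes the downshift: row t of [front] drives row t of
    [tail]. *)
Definition tail {R : realType} {T n l : nat}
    (M : 'M[R]_(\sum_(i < T.+1) n, l)) : 'M[R]_(\sum_(i < T) n, l) :=
  \mxcol_(t < T) submxcol M (lift ord0 t).

Definition front {R : realType} {T n l : nat}
    (M : 'M[R]_(\sum_(i < T.+1) n, l)) : 'M[R]_(\sum_(i < T) n, l) :=
  \mxcol_(t < T) submxcol M (now t).

Lemma mulmx_split_first {R : realType} {T n l : nat}
    (M : 'M[R]_(l, \sum_(i < T.+1) n)) (Y : 'cV[R]_(\sum_(i < T.+1) n)) :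
  M *m Y = blkcol0 M *m submxcol Y ord0 + blkcols_w M *m tail Y.
Proof.
rewrite -{1}[M]submxrowK -{1}[Y]submxcolK !mul_mxrow_mxcol big_ord_recl.
by [].
Qed.

Lemma front_mulmx {R : realType} {T n k l : nat}
    (M : 'M[R]_(\sum_(i < T.+1) n, k)) (N : 'M[R]_(k, l)) :
  front (M *m N) = front M *m N.
Proof. by rewrite mxcol_mul; apply: eq_mxcol => t; rewrite submxcol_mul. Qed.

Lemma norm_oo_front {R : realType} {T n l : nat}
    (M : 'M[R]_(\sum_(i < T.+1) n, l)) :
  norm_oo (front M) <= norm_oo M.
Proof.
apply/bigmax_leP; split=> [|s _]; first exact: norm_oo_ge0.
pose s' := tagnat.Rank (now (tagnat.sig1 s)) (tagnat.sig2 s).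
rewrite (eq_bigr (fun j => `|M s' j|)) => [|j _]; last by rewrite !mxE.
exact: norm_oo_row_sum.
Qed.

Lemma front_delayed {R : realType} {T p q : nat} (M : opmx R T p q) :
  L_TV M -> delayed block_time block_time 0 (front M).
Proof.
move=> /L_TV_delayed dM s c lt_sc; rewrite !mxE dM //.
by rewrite /block_time tagnat.Rank1K.
Qed.

(** The column block that [blkcols_w] numbers t is the one of time t+1; this
    renumbering is the source of the unit delay that makes the loop
    nilpotent. *)
Lemma blkcols_w_delayed {R : realType} {T p q : nat} (M : opmx R T p q) :
  L_TV M -> delayed block_time block_time 1 (blkcols_w M).
Proof.
move=> /L_TV_delayed dM s c lt_sc; rewrite !mxE dM //.
by move: lt_sc; rewrite /block_time tagnat.Rank1K lift0 addn0 addn1.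
Qed.

Lemma blkcols_w_vsplit {R : realType} {T n p q : nat}
    (M : 'M[R]_(p + q, \sum_(j < T.+1) n)) :
  blkcols_w M = col_mx (blkcols_w (usubmx M)) (blkcols_w (dsubmx M)).
Proof.
apply/matrixP => i j; rewrite !mxE.
by case: split_ordP => k ->; rewrite !mxE.
Qed.

Lemma blkcol0_vsplit {R : realType} {T n p q : nat}
    (M : 'M[R]_(p + q, \sum_(j < T.+1) n)) :
  blkcol0 M = col_mx (blkcol0 (usubmx M)) (blkcol0 (dsubmx M)).
Proof.
apply/matrixP => i j; rewrite !mxE.
by case: split_ordP => k ->; rewrite !mxE.
Qed.

(** * System responses and the closed loop *)

Lemma L_TV_mul {R : realType} {T p q r : nat} (M : opmx R T p q)
    (N : opmx R T q r) : L_TV M -> L_TV N -> L_TV (M *m N).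
Proof.
move=> /L_TV_delayed dM /L_TV_delayed dN; apply/L_TV_delayed.
exact: delayed_mul dM dN.
Qed.

(** The affine constraint is Phi_x = 1 + Z (A Phi_x + B Phi_u), and the
    downshift Z delays by one step. *)
Lemma response_unit {R : realType} {T n m : nat} (A : opmx R T n n)
    (B : opmx R T n m) (Phi : respmx R T n m) :
  L_TV A -> L_TV B -> L_TV (usubmx Phi) -> L_TV (dsubmx Phi) ->
  row_mx (1%:M - downshift R T n *m A) (- (downshift R T n *m B)) *m Phi
    = 1%:M ->
  usubmx Phi \in unitmx /\ L_TV (invmx (usubmx Phi)).
Proof.
move=> cA cB cx cu; rewrite -{1}[Phi]vsubmxK mul_row_col.
set Z := downshift R T n; set X := usubmx Phi; set U := dsubmx Phi => affine.
pose N : 'M[R]_(\sum_(i < T.+1) n) := - (Z *m (A *m X + B *m U)).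
have X_eq : X = 1%:M - N.
  rewrite -affine /N opprK mulmxDr !mulmxA mulmxBl mul1mx mulNmx.
  by rewrite addrACA addNr addr0 subrK.
have dN : delayed block_time block_time 1 N.
  apply: delayed_opp; rewrite -[1%N]addn0.
  apply: delayed_mul downshift_delayed _; apply: delayed_add.
    by apply/L_TV_delayed; exact: L_TV_mul.
  by apply/L_TV_delayed; exact: L_TV_mul.
have [] := delayed_inverse block_time T.+1 N block_time_lt dN.
by rewrite -X_eq => uX /L_TV_delayed.
Qed.

(** Reading the affine constraint on a trajectory [X], [V] identifies [eta] as
    the initial state followed by the one-step prediction errors of the nominal
    model. *)
Lemma response_residual {R : realType} {T n m : nat}
    (A : 'I_T -> 'M[R]_n) (B : 'I_T -> 'M[R]_(n, m))
    (X eta : 'cV[R]_(\sum_(i < T.+1) n)) (V : 'cV[R]_(\sum_(i < T.+1) m)) :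
  row_mx (1%:M - downshift R T n *m blkdiag_last A 0)
         (- (downshift R T n *m blkdiag_last B 0)) *m col_mx X V = eta ->
  submxcol eta ord0 = submxcol X ord0 /\
  forall t : 'I_T, submxcol eta (lift ord0 t) =
    submxcol X (lift ord0 t)
    - (A t *m submxcol X (now t) + B t *m submxcol V (now t)).
Proof.
move=> <-; rewrite mul_row_col mulmxBl mul1mx mulNmx -!mulmxA -addrA -opprD.
rewrite -mulmxDr; split=> [|t]; rewrite submxcolB.
  by rewrite downshift_mulmx0 subr0.
by rewrite downshift_mulmx_next submxcolD !blkdiag_last_mulmx_now.
Qed.

Lemma stacked_polytope {R : realType} {T n m cx cT cu : nat}
    (Fx : 'M[R]_(cx, n)) (bx : 'cV[R]_cx) (FT : 'M[R]_(cT, n))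
    (bT : 'cV[R]_cT) (Fu : 'M[R]_(cu, m)) (bu : 'cV[R]_cu)
    (X : 'cV[R]_(\sum_(i < T.+1) n)) (V : 'cV[R]_(\sum_(i < T.+1) m)) :
  polytope (stack_F T Fx FT Fu) (stack_b T bx bT bu) (col_mx X V) ->
  [/\ forall t : 'I_T, polytope Fx bx (submxcol X (now t)),
      forall i : 'I_T.+1, polytope Fu bu (submxcol V i)
    & polytope FT bT (submxcol X ord_max)].
Proof.
rewrite /polytope /stack_F /stack_b /= mul_block_col !mul0mx addr0 add0r.
move=> poly.
have poly_x i s : (state_F Fx FT i *m submxcol X i) s 0 <= state_b bx bT i s 0.
  have := poly (lshift _ (tagnat.Rank i s)); rewrite !col_mxEu.
  rewrite -[X in _ *m X]submxcolK blkdiag_mulmx.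
  by rewrite !mxcol_Rank.
split=> [t s|i s|s].
- have /negPf now_max : now t != ord_max.
    by rewrite -val_eqE /= neq_ltn ltn_ord.
  move: (poly_x (now t)); rewrite /state_F /state_b /state_rows now_max.
  exact.
- have := poly (rshift _ (tagnat.Rank i s)); rewrite !col_mxEd.
  rewrite -[X in _ *m X]submxcolK blkdiag_mulmx.
  by rewrite !mxcol_Rank.
- move: (poly_x ord_max); rewrite /state_F /state_b /state_rows eqxx.
  exact.
Qed.

(** Along the closed loop the prediction errors of the nominal model consist of
    the model uncertainty and the disturbance.  The input at time T, which the
    closed loop leaves open, is chosen by the same feedback law, so that the
    stacked input is K X. *)
Lemma closed_loop_response {R : realType} {T n m : nat}
    (A : 'I_T -> 'M[R]_n) (B : 'I_T -> 'M[R]_(n, m))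
    (dA : opmx R T n n) (dB : opmx R T n m) (w : 'I_T -> 'cV[R]_n)
    (Phi : respmx R T n m) (x0 : 'cV[R]_n) (x : 'I_T.+1 -> 'cV[R]_n)
    (u : 'I_T -> 'cV[R]_m) :
  row_mx (1%:M - downshift R T n *m blkdiag_last A 0)
         (- (downshift R T n *m blkdiag_last B 0)) *m Phi = 1%:M ->
  usubmx Phi \in unitmx -> L_TV (slp_controller Phi) ->
  L_TV dA -> L_TV dB ->
  closed_loop A B dA dB w (slp_controller Phi) x0 x u ->
  let X := \mxcol_i x i in
  let V := slp_controller Phi *m X in
  let eta := invmx (usubmx Phi) *m X in
  [/\ Phi *m eta = col_mx X V,
      forall t, submxcol V (now t) = u t,
      submxcol eta ord0 = x0
    & tail eta = front dA *m X + front dB *m V + \mxcol_t w t].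
Proof.
move=> affine uX cK cdA cdB [x_init x_next u_eq] X V eta.
have Phi_eta : Phi *m eta = col_mx X V.
  by rewrite -[Phi]vsubmxK mul_col_mx mulKVmx // mulmxA.
have V_now (t : 'I_T) : submxcol V (now t) = u t.
  by rewrite causal_mulmx_now // u_eq; under eq_bigr do rewrite mxcolK.
have [eta_init eta_next] : submxcol eta ord0 = submxcol X ord0 /\
    forall t : 'I_T, submxcol eta (lift ord0 t) =
      submxcol X (lift ord0 t)
      - (A t *m submxcol X (now t) + B t *m submxcol V (now t)).
  by apply: response_residual; rewrite -Phi_eta mulmxA affine mul1mx.
split=> //; first by rewrite eta_init mxcolK.
rewrite -!front_mulmx -!mxcolD; apply: eq_mxcol => t.
rewrite eta_next !mxcolK V_now [x (lift ord0 t)]x_next !causal_mulmx_now //.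
under [X in _ = X + _ + _]eq_bigr do rewrite mxcolK.
under [X in _ = _ + X + _]eq_bigr do rewrite V_now.
set a := A t *m _; set b := B t *m _.
set c := \sum_(i < T | _) _; set d := \sum_(i < T | _) _.
rewrite [a + c]addrC -(addrA c) [c + (a + b)]addrC -!(addrA (a + b)).
by rewrite [LHS]addrC subrK.
Qed.

Theorem theorem4 (R : realType) (T n m : nat)
    (T_ge1 : (1 <= T)%N) (n_ge1 : (1 <= n)%N) (m_ge1 : (1 <= m)%N)
    (epsA epsB sigw : R)
    (epsA_ge0 : 0 <= epsA) (epsB_ge0 : 0 <= epsB) (sigw_ge0 : 0 <= sigw)
    (Ahat : 'I_T -> 'M[R]_n) (Bhat : 'I_T -> 'M[R]_(n, m))
    (cx cT cu : nat)
    (Fx : 'M[R]_(cx, n)) (bx : 'cV[R]_cx)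
    (FT : 'M[R]_(cT, n)) (bT : 'cV[R]_cT)
    (Fu : 'M[R]_(cu, m)) (bu : 'cV[R]_cu)
    (Q : 'I_T -> 'M[R]_n) (QT : 'M[R]_n) (W : 'I_T -> 'M[R]_m)
    (Q_psd : forall t, psdmx (Q t)) (QT_psd : psdmx QT)
    (W_posdef : forall t, posdefmx (W t))
    (x0 : 'cV[R]_n)
    (tau gamma beta : R)
    (tau_gt0 : 0 < tau) (gamma_gt0 : 0 < gamma) (beta_gt0 : 0 < beta)
    (Phi : respmx R T n m)
    (Phi_feasible :
       feasible
         (robust_slp (blkdiag_last Ahat 0) (blkdiag_last Bhat 0)
            (blkdiag_last Q QT) (blkdiag_last W 0)
            (stack_F T Fx FT Fu) (stack_b T bx bT bu)
            epsA epsB sigw x0 tau gamma beta)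
         Phi) :
  [/\ usubmx Phi \in unitmx,
      L_TV (slp_controller Phi)
    & forall (dA : opmx R T n n) (dB : opmx R T n m) (w : 'I_T -> 'cV[R]_n),
        L_TV dA -> norm_oo dA <= epsA ->
        L_TV dB -> norm_oo dB <= epsB ->
        (forall t, `|w t| <= sigw) ->
        forall (x : 'I_T.+1 -> 'cV[R]_n) (u : 'I_T -> 'cV[R]_m),
          closed_loop Ahat Bhat dA dB w (slp_controller Phi) x0 x u ->
          [/\ forall t : 'I_T, polytope Fx bx (x (now t)),
              forall t : 'I_T, polytope Fu bu (u t)
            & polytope FT bT (x ord_max)]].
Proof.
have [cX cU affine tight betaP tauP gammaP] := Phi_feasible.
have cA : L_TV (blkdiag_last Ahat 0).
  exact/L_TV_delayed/blkdiag_last_delayed.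
have cB : L_TV (blkdiag_last Bhat 0).
  exact/L_TV_delayed/blkdiag_last_delayed.
have [uX cXV] := response_unit _ _ _ cA cB cX cU affine.
have cK : L_TV (slp_controller Phi) by exact: L_TV_mul.
split=> // dA dB w cdA dA_le cdB dB_le w_le x u loop.
have [] := closed_loop_response _ _ _ _ _ _ _ _ _ affine uX cK cdA cdB loop.
set X := \mxcol_i x i; set V := slp_controller Phi *m X.
set eta := invmx _ *m X => Phi_eta V_now eta0 eta_next.
have split_z : Phi *m eta = blkcol0 Phi *m x0 + blkcols_w Phi *m tail eta.
  by rewrite mulmx_split_first eta0.
pose D := row_mx (front dA) (front dB).
have tail_eq : tail eta = D *m blkcols_w Phi *m tail eta
    + (D *m blkcol0 Phi *m x0 + \mxcol_t w t).
  rewrite addrA -!mulmxA -mulmxDr [_ + blkcol0 _ *m _]addrC -split_z Phi_eta.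
  by rewrite mul_row_col.
have nilp : (D *m blkcols_w Phi) ^+ T = 0.
  apply: (delayed_nilpotent block_time); first exact: block_time_lt.
  rewrite blkcols_w_vsplit mul_row_col.
  apply: delayed_add; rewrite -[1%N]add0n.
    exact: delayed_mul (front_delayed _ cdA) (blkcols_w_delayed _ cX).
  exact: delayed_mul (front_delayed _ cdB) (blkcols_w_delayed _ cU).
have fA_le := le_trans (norm_oo_front dA) dA_le.
have fB_le := le_trans (norm_oo_front dB) dB_le.
have D_tau (y : 'cV[R]_(\sum_(t < T) n)) :
    `|D *m blkcols_w Phi *m y| <= tau * `|y|.
  rewrite -mulmxA blkcols_w_vsplit mul_col_mx mul_row_col.
  rewrite (le_trans (perturbation_le_scaled epsA epsB _ _ _ _ _ _ _ _)) //.
  rewrite !scalemxAl -mul_col_mx -ler_pdivlMl // mulrCA mulrA.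
  exact: le_trans (norm_oo_mul _ _) (ler_wpM2r (normr_ge0 y) tauP).
have D_rho (y : 'cV[R]_(\sum_(t < T) n)) :
    `|D *m blkcols_w Phi *m y|
      <= norm_oo ((epsA + epsB) *: blkcols_w Phi) * `|y|.
  rewrite -mulmxA blkcols_w_vsplit mul_col_mx mul_row_col.
  rewrite (le_trans (perturbation_le_sum epsA epsB _ _ _ _ _ _)) //.
  rewrite -mul_col_mx -blkcols_w_vsplit.
  rewrite -[epsA + epsB]ger0_norm ?addr_ge0 // -cVnormZ scalemxAl.
  rewrite ger0_norm ?addr_ge0 //; exact: norm_oo_mul.
have c_le : `|D *m blkcol0 Phi *m x0| <= gamma.
  rewrite -mulmxA blkcol0_vsplit mul_col_mx mul_row_col.
  rewrite (le_trans (perturbation_le_scaled epsA epsB _ _ _ _ _ _ _ _)) //.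
  by rewrite !scalemxAl -mul_col_mx -ler_pdivlMl // mulrC.
have W_le : `|\mxcol_t w t| <= sigw.
  apply: cVnorm_le => // s; rewrite mxE.
  exact: le_trans (cVnorm_ge _ _) (w_le _).
have [px pu pT] : [/\ forall t : 'I_T, polytope Fx bx (submxcol X (now t)),
      forall i : 'I_T.+1, polytope Fu bu (submxcol V i)
    & polytope FT bT (submxcol X ord_max)].
  apply: stacked_polytope => j; rewrite -Phi_eta.
  have -> : (stack_F T Fx FT Fu *m (Phi *m eta)) j 0 =
      (row j (stack_F T Fx FT Fu) *m (Phi *m eta)) 0 0
    by rewrite -row_mul [RHS]mxE.
  apply: le_trans (tight j); rewrite split_z mulmxDr mxE !mulmxA -addrA.
  rewrite lerD2l.
  exact: (robust_row_bound nilp tail_eq (ltW tau_gt0) (ltW beta_gt0)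
            D_tau D_rho c_le W_le).
split.
- by move=> t; have := px t; rewrite mxcolK.
- by move=> t; rewrite -V_now; exact: pu.
- by have := pT; rewrite mxcolK.
Qed.
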